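(* For every (finite) matrix $M$ with entries in $\{0,1,-1\}$, the geometric grid class $\mathrm{Geom}(M)$ is labelled well-quasi-ordered (lwqo).
   Context: A permutation of length $n$ is an arrangement $\pi=\pi(1)\cdots\pi(n)$ of $1,\dots,n$ (the empty permutation is allowed). Matrices are indexed in Cartesian coordinates, so $M(k,\ell)$ is the entry in the $k$th column from the left and the $\ell$th row from the bottom. The standard figure $\Lambda_M\subset\mathbb{R}^2$ of a $\{0,1,-1\}$ matrix $M$ is the union of: the line segment from $(k-1,\ell-1)$ to $(k,\ell)$ for each $(k,\ell)$ with $M(k,\ell)=1$, and the line segment from $(k-1,\ell)$ to $(k,\ell-1)$ for each $(k,\ell)$ with $M(k,\ell)=-1$. A point set in the plane is independent if no two of its points lie on a common horizontal or vertical line. A finite independent set with $n$ points is in the same relative order as (the plot $\{(i,\pi(i))\}$ of) a unique permutation $\pi$ of length $n$, obtained by labelling the points $1,\dots,n$ from bottom to top and reading the labels from left to right. $\mathrm{Geom}(M)$ is the set of all permutations that are in the same relative order as some finite independent subset of $\Lambda_M$. A quasi-order $(Y,\le)$ is well-quasi-ordered (wqo) if every infinite sequence $y_1,y_2,\dots$ in $Y$ has indices $i<j$ with $y_i\le y_j$. Given a quasi-order $(L,\le_L)$, an $L$-labelled permutation is a pair $(\pi,\ell_\pi)$ with $\pi$ a permutation of length $n$ and $\ell_\pi:\{1,\dots,n\}\to L$. We say $(\sigma,\ell_\sigma)\le(\pi,\ell_\pi)$, where $\sigma$ and $\pi$ have lengths $k$ and $n$, if there are indices $1\le i_1<\cdots<i_k\le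 n$ such that $\pi(i_1)\cdots\pi(i_k)$ is order isomorphic to $\sigma$ and $\ell_\sigma(j)\le_L\ell_\pi(i_j)$ for all $1\le j\le k$. For a set $X$ of permutations, $X\wr L$ is the set of all $L$-labelled members of $X$ under this order. The set $X$ is lwqo if $X\wr L$ is wqo for every wqo $(L,\le_L)$. *)

(* Defs.v *)
From mathcomp Require Import all_boot all_order all_algebra all_fingroup.
From mathcomp Require Import boolp classical_sets functions cardinality reals.

Set Implicit Arguments.
Unset Strict Implicit.
Unset Printing Implicit Defensive.

Import Order.TTheory GRing.Theory Num.Theory.
Local Open Scope classical_set_scope.
Local Open Scope ring_scope.

(* Positions and values are 0-based: [tagged pi i] is one less than the
   usual value of pi at the one-based position i + 1. *)
Definition permutation := {n : nat & 'S_n}.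

Definition plength (pi : permutation) : nat := tag pi.

Definition pvalue (pi : permutation) : 'I_(plength pi) -> 'I_(plength pi) :=
  fun i => tagged pi i.

Definition segment (R : realType) (p q : R * R) : set (R * R) :=
  [set z | exists2 s : R, 0 <= s <= 1 &
     z = ((1 - s) * p.1 + s * q.1, (1 - s) * p.2 + s * q.2)].

(* Cartesian indexing: the FIRST index of [M] is the column, counted from the
   left, and the second one is the row, counted from the bottom.  As indices
   start at 0, the cell (k, l) is the square [k, k + 1] x [l, l + 1]. *)
Definition standard_figure (R : realType) (t u : nat) (M : 'M[int]_(t, u)) :
    set (R * R) :=
  [set z | exists (k : 'I_t) (l : 'I_u),
     (M k l = 1 /\ segment (k%:R, l%:R) (k.+1%:R, l.+1%:R) z) \/
     (M k l = -1 /\ segment (k%:R, l.+1%:R) (k.+1%:R, l%:R) z)].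

Definition independent (R : realType) (A : set (R * R)) : Prop :=
  forall p q, A p -> A q -> p <> q -> p.1 <> q.1 /\ p.2 <> q.2.

Definition plot (R : realType) (pi : permutation) : set (R * R) :=
  [set z | exists i : 'I_(plength pi), z = (i.+1%:R, (pvalue i).+1%:R)].

Definition same_relative_order (R : realType) (A B : set (R * R)) : Prop :=
  exists f : R * R -> R * R, set_bij A B f /\
    forall p q, A p -> A q ->
      (p.1 < q.1 <-> (f p).1 < (f q).1) /\ (p.2 < q.2 <-> (f p).2 < (f q).2).

Definition Geom (R : realType) (t u : nat) (M : 'M[int]_(t, u)) :
    set permutation :=
  [set pi | exists A : set (R * R),
     [/\ finite_set A, independent A, A `<=` standard_figure M
       & same_relative_order A (plot pi)]].

Definition quasi_order (Y : Type) (le : Y -> Y -> Prop) : Prop :=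
  (forall x, le x x) /\ (forall x y z, le x y -> le y z -> le x z).

Definition wqo (Y : Type) (le : Y -> Y -> Prop) : Prop :=
  quasi_order le /\
  forall y : nat -> Y, exists i j : nat, (i < j)%N /\ le (y i) (y j).

Record labelled (X : set permutation) (L : Type) := Labelled {
  lperm : permutation;
  lperm_in : X lperm;
  label : 'I_(plength lperm) -> L
}.

Definition labelled_le (X : set permutation) (L : Type)
    (leL : L -> L -> Prop) (s p : labelled X L) : Prop :=
  exists f : 'I_(plength (lperm s)) -> 'I_(plength (lperm p)),
    [/\ forall i j : 'I_(plength (lperm s)), (i < j)%N -> (f i < f j)%N,
        forall i j : 'I_(plength (lperm s)),
          (pvalue i < pvalue j)%N <-> (pvalue (f i) < pvalue (f j))%N
      & forall j : 'I_(plength (lperm s)), leL (label j) (label (f j))].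

Definition lwqo (X : set permutation) : Prop :=
  forall (L : Type) (leL : L -> L -> Prop),
    wqo leL -> wqo (@labelled_le X L leL).

(* Main.v *)
(** Cut every cell in half at its midpoint, and let [d] in [[0, 1/2]] be the
    distance of the parameter of a point of the figure to the nearer end of its
    segment.  Within one half-column the abscissa is a monotone function of [d]
    whose direction depends on the half-column only, and likewise for
    half-rows; points in different half-columns compare as the half-columns do.
    So the permutation is determined by the word of half-cells obtained by
    listing its points by increasing [d], and an embedding of such words that
    respects half-cells and labels is an embedding of labelled permutations.
    Words over a product of a finite alphabet with a wqo of labels are wqo by
    Higman's lemma. *)
Require Import Defs.
From mathcomp Require Import all_boot all_order all_algebra all_fingroup.
From mathcomp Require Import boolp classical_sets functions cardinality reals.
From mathcomp Require Import zify lra.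

Set Implicit Arguments.
Unset Strict Implicit.
Unset Printing Implicit Defensive.

Import Order.TTheory GRing.Theory Num.Theory.
Local Open Scope ring_scope.

(** * Well-quasi-orders: monotone subsequences and finite products *)

Lemma wqo_monotone_subsequence (Y : Type) (le : Y -> Y -> Prop) (y : nat -> Y) :
  wqo le -> exists h : nat -> nat,
    (forall i j, (i < j)%N -> (h i < h j)%N) /\
    (forall i j, (i < j)%N -> le (y (h i)) (y (h j))).
Proof.
move=> [[_ le_trans] wY].
pose terminal i := forall j, (i < j)%N -> ~ le (y i) (y j).
(* Infinitely many terminal indices would form a bad sequence. *)
have [N HN] : exists N, forall i, (N <= i)%N -> ~ terminal i.
  apply: contrapT => noN.
  have next N : exists i, (N <= i)%N /\ terminal i.
    apply: contrapT => nex; apply: noN; exists N => i Ni ti.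
    by apply: nex; exists i.
  have [g gP] := choice next.
  pose h := fix h n := if n is m.+1 then g (h m).+1 else g 0%N.
  have h_term n : terminal (h n) by case: n => [|n]; apply: (gP _).2.
  have h_inc : {homo h : i j / (i < j)%N}.
    by apply: homo_ltn ltn_trans _ => n; apply: (gP _).1.
  have [i [j [ij leij]]] := wY (y \o h).
  exact: (h_term i _ (h_inc _ _ ij) leij).
have next i : exists j, (N <= i)%N -> (i < j)%N /\ le (y i) (y j).
  have [Ni|_] := boolP (N <= i)%N; last by exists 0%N.
  apply: contrapT => nex; apply: (HN i Ni) => j ij leij.
  by apply: nex; exists j.
have [g gP] := choice next.
(* No index from [N] on is terminal, so iterating [g] from [N] climbs along [le] forever. *)
pose h n := iter n g N.
have hN n : (N <= h n)%N.
  elim: n => //= n IHn; apply: (leq_trans IHn).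
  exact: ltnW (gP _ IHn).1.
exists h; split.
  by apply: homo_ltn ltn_trans _ => n; apply: (gP _ (hN n)).1.
have y_step n : le (y (h n)) (y (h n.+1)) by apply: (gP _ (hN n)).2.
exact: (homo_ltn (f := y \o h) (fun b a c => le_trans a b c) y_step).
Qed.

Lemma wqo_finType_prod (T : finType) (L : Type) (leL : L -> L -> Prop) :
  wqo leL -> wqo (fun p q : T * L => p.1 = q.1 /\ leL p.2 q.2).
Proof.
move=> wL; have [[leL_refl leL_trans] _] := wL.
split; first split=> [p|p q r [-> pq] [-> qr]] //.
  by split=> //; apply: leL_trans pq qr.
move=> y.
have [h [h_inc h_le]] := wqo_monotone_subsequence (fun n => (y n).2) wL.
(* Pigeonhole: labels already ascend along [h], and among [#|T|.+1] terms two share their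
   [T]-component. *)
pose c (i : 'I_#|T|.+1) := (y (h i)).1.
have /injectivePn[i [j ij cij]] : ~~ injectiveb c.
  apply/negP => /injectiveP /leq_card; rewrite card_ord; lia.
wlog lt_ij : i j ij cij / (i < j)%N.
  move=> W; case: (ltngtP i j) => [lt_ij|lt_ji|/val_inj eq_ij].
  - exact: (W i j).
  - by apply: (W j i); rewrite // eq_sym.
  - by rewrite eq_ij eqxx in ij.
by exists (h i), (h j); split; [apply: h_inc|split; [|apply: h_le]].
Qed.

(** * Word embeddings and Higman's lemma *)

(** Two letter types are allowed because words will be pulled back to lists of positions in two
    different permutations. *)
Inductive embeds (A B : Type) (P : A -> B -> Prop) : seq A -> seq B -> Prop :=
| embeds_nil t : embeds P [::] t
| embeds_skip s y t : embeds P s t -> embeds P s (y :: t)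
| embeds_cons x s y t : P x y -> embeds P s t -> embeds P (x :: s) (y :: t).

Lemma embeds_map (A B A' B' : Type) (P : A' -> B' -> Prop)
    (f : A -> A') (g : B -> B') (s : seq A) (t : seq B) :
  embeds P (map f s) (map g t) -> embeds (fun a b => P (f a) (g b)) s t.
Proof.
elim: t s => [|y t IHt] [|x s] //= E; try exact: embeds_nil.
  by inversion E.
inversion E as [|? ? ? E'|? ? ? ? Pxy E']; subst.
  by apply: embeds_skip; apply: IHt.
by apply: embeds_cons => //; apply: IHt.
Qed.

Section Higman.
Variables (X : Type) (le : X -> X -> Prop).
Hypothesis wX : wqo le.

Let bad (f : nat -> seq X) := forall i j, (i < j)%N -> ~ embeds le (f i) (f j).

Let minimal_bad (m : nat -> seq X) := bad m /\
  forall n g, bad g -> (forall i, (i < n)%N -> g i = m i) ->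
    (size (m n) <= size (g n))%N.

(** Nash-Williams's greedy construction: a prefix that extends to a bad sequence is prolonged by a
    shortest word that keeps it extendable. *)
Lemma minimal_bad_exists f0 : bad f0 -> exists m, minimal_bad m.
Proof.
move=> bad0.
pose ext (p : seq (seq X)) :=
  exists2 f, bad f & forall i, (i < size p)%N -> f i = nth [::] p i.
have step p : exists x, ext p -> ext (rcons p x) /\
    forall x', ext (rcons p x') -> (size x <= size x')%N.
  have [extp|] := EM (ext p); last by exists [::].
  pose Q n := `[< exists x, ext (rcons p x) /\ size x = n >].
  have exQ : exists n, Q n.
    case: extp => f badf fp; exists (size (f (size p))); apply/asboolP.
    exists (f (size p)); split=> //; exists f => // i.
    rewrite size_rcons ltnS leq_eqVlt nth_rcons => /orP[/eqP ->|ip].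
      by rewrite ltnn eqxx.
    by rewrite ip fp.
  case: (ex_minnP exQ) => n /asboolP[x [extx <-]] minx.
  exists x => _; split=> // x' extx'; apply: minx; apply/asboolP.
  by exists x'.
have [c cP] := choice step.
pose P := fix P n := if n is k.+1 then rcons (P k) (c (P k)) else [::].
pose m n := c (P n).
have sizeP n : size (P n) = n by elim: n => //= n IHn; rewrite size_rcons IHn.
have nthP n i : (i < n)%N -> nth [::] (P n) i = m i.
  elim: n => //= n IHn; rewrite ltnS leq_eqVlt nth_rcons sizeP.
  by case/orP=> [/eqP ->|lt_in]; rewrite ?ltnn ?eqxx // lt_in IHn.
have extP n : ext (P n).
  elim: n => [|n IHn]; first by exists f0.
  exact: (cP _ IHn).1.
exists m; split=> [i j ij|n g badg gm].
  (* Two terms of [m] lie in a common finite prefix, which some bad sequence continues. *)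
  have [f badf fP] := extP j.+1; rewrite sizeP in fP.
  rewrite -(nthP j.+1) ?(ltn_trans ij) // -(nthP j.+1 j) //.
  by rewrite -!fP ?(ltn_trans ij) //; apply: badf.
apply: (cP _ (extP n)).2; exists g => // i.
rewrite size_rcons sizeP ltnS leq_eqVlt nth_rcons sizeP => /orP[/eqP ->|lt_in].
  by rewrite ltnn eqxx.
by rewrite lt_in nthP // gm.
Qed.

Lemma higman (f : nat -> seq X) :
  exists i j, (i < j)%N /\ embeds le (f i) (f j).
Proof.
apply: contrapT => nf.
have /minimal_bad_exists[m [badm minm]] : bad f.
  by move=> i j ij fij; apply: nf; exists i, j.
have mcons n : exists p, m n = p.1 :: p.2.
  case E: (m n) => [|x s]; last by exists (x, s).
  by case: (badm n n.+1 (ltnSn n)); rewrite E; apply: embeds_nil.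
have [p mE] := choice mcons.
have [h [h_inc h_le]] := wqo_monotone_subsequence (fun n => (p n).1) wX.
(* Keep [m] before [h 0], then take the words [m (h k)] without their ascending first letters.
   Badness of [g] contradicts minimality at [h 0], where its word is one letter shorter. *)
pose g i := if (i < h 0)%N then m i else (p (h (i - h 0)%N)).2.
have h0_le n : (h 0%N <= h n)%N by case: n => // n; apply: ltnW; apply: h_inc.
have badg : bad g.
  move=> i j ij; rewrite /g; case: ltnP => ih; case: ltnP => jh.
  - exact: badm.
  - move=> E; apply: (badm i (h (j - h 0)%N)).
      exact: leq_trans ih (h0_le _).
    by rewrite [m (h _)]mE; apply: embeds_skip.
  - by have := leq_trans (ltn_trans ij jh) ih; rewrite ltnn.
  - have lt_ij : (i - h 0 < j - h 0)%N by lia.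
    move=> E; apply: (badm _ _ (h_inc _ _ lt_ij)).
    by rewrite !mE; apply: embeds_cons => //; apply: h_le.
have := minm (h 0%N) g badg.
rewrite {2}/g ltnn subnn mE /= ltnn => /(_ _)/negP; case=> // i ih.
by rewrite /g ih.
Qed.

End Higman.

(** Makes a word embedding act on positions. Sorting orders ties arbitrarily, so only a strict
    inequality of [dA] fixes the order of two letters, and their images are then only weakly ordered
    by [dB]; [uniq t] keeps them distinct. *)
Lemma embeds_sorted_choice (R : realType) (A B : eqType) (P : A -> B -> Prop)
    (dA : A -> R) (dB : B -> R) (s : seq A) (t : seq B) :
  embeds P s t ->
  pairwise (fun a a' => dA a <= dA a') s ->
  pairwise (fun b b' => dB b <= dB b') t -> uniq t ->
  exists Q : A -> B -> Prop,
    [/\ forall a, a \in s -> exists b, Q a b,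
        forall a b, Q a b -> [/\ a \in s, b \in t & P a b]
      & forall a b a' b', Q a b -> Q a' b' -> dA a < dA a' ->
          b <> b' /\ dB b <= dB b'].
Proof.
elim=> {s t} [t|s y t _ IH|x s y t Pxy _ IH] /=.
- by move=> *; exists (fun _ _ => False); split.
- move=> ss /andP[_ st] /andP[_ ut]; have [Q [Qex QP Qd]] := IH ss st ut.
  exists Q; split=> // a b /QP[as_ bt Pab]; split=> //.
  by rewrite inE bt orbT.
- move=> /andP[/allP xs ss] /andP[/allP yt st] /andP[ynt ut].
  have [Q [Qex QP Qd]] := IH ss st ut.
  exists (fun a b => (a = x /\ b = y) \/ Q a b); split.
  + move=> a; rewrite inE => /orP[/eqP ->|/Qex[b Qab]].
      by exists y; left.
    by exists b; right.
  + move=> a b [[-> ->]|/QP[as_ bt Pab]]; first by rewrite !mem_head.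
    by rewrite !inE as_ bt !orbT.
  + move=> a b a' b' [[-> ->]|Qab] [[-> ->]|Qab'].
    * by rewrite ltxx.
    * have [_ bt _] := QP _ _ Qab' => _; split; last exact: yt.
      by move=> yb; rewrite yb bt in ynt.
    * have [as_ _ _] := QP _ _ Qab.
      by rewrite ltNge xs.
    * exact: Qd Qab Qab'.
Qed.

(** * Half-cells and the encoding of points of the figure *)

(* The [b = false] half of column [k] has index [2 k], the other [2 k + 1]. *)
Definition half_index (t : nat) (a : 'I_t * bool) : nat := (a.1.*2 + a.2)%N.

Definition half_lt (R : realType) (t : nat) (a a' : 'I_t * bool) (d d' : R) :=
  (half_index a < half_index a')%N \/
  a = a' /\ (if a.2 then d' < d else d < d').

Definition offset (R : realType) (t : nat) (a : 'I_t * bool) (d : R) : R :=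
  a.1%:R + (if a.2 then 1 - d else d).

Lemma half_index_inj (t : nat) : injective (@half_index t).
Proof.
move=> [k b] [k' b']; rewrite /half_index /= => E.
have [Ek ->] : k = k' :> nat /\ b = b' by case: b b' E => [] []; lia.
by congr pair; apply: val_inj.
Qed.

(** Distinct halves are closed intervals sharing at most an endpoint, so a strict inequality of
    coordinates cannot oppose the order of the halves. *)
Lemma offset_lt_half_lt (R : realType) (t : nat) (a a' : 'I_t * bool)
    (d d' : R) :
  0 <= d <= 2^-1 -> 0 <= d' <= 2^-1 ->
  offset a d < offset a' d' -> half_lt a a' d d'.
Proof.
move=> dP dP' lt_o; rewrite /half_lt.
have [||/half_index_inj E] := ltngtP (half_index a) (half_index a').
- by left.
- move: lt_o; rewrite /half_index /offset.
  case: a a' => [k b] [k' b'] /= lt_o lt_i.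
  suff: (k' < k)%N \/ [/\ k' = k :> nat, b & ~~ b'].
    case=> [lt_k|[Ek bT bF]].
      have : k'%:R + 1 <= k%:R :> R by rewrite natr1 ler_nat.
      by case: b b' lt_o {lt_i} => [] []; lra.
    by move: lt_o; rewrite bT (negbTE bF) Ek; lra.
  have [lt_k|gt_k|E] := ltngtP k' k; first by left.
    by case: b b' lt_i {lt_o} => [] []; lia.
  by right; case: b b' lt_i {lt_o} => [] [] //; lia.
- right; split=> //; move: lt_o; rewrite /offset -E.
  by case: a {E} => k [] /=; lra.
Qed.

(** One [d] serves both axes: this lets a single word record the horizontal and the vertical order
    at once. *)
Definition encodes (R : realType) (t u : nat) (pi : permutation)
    (cell : 'I_(plength pi) -> ('I_t * bool) * ('I_u * bool))
    (d : 'I_(plength pi) -> R) : Prop :=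
  (forall i j : 'I_(plength pi), (i < j)%N ->
     half_lt (cell i).1 (cell j).1 (d i) (d j)) /\
  (forall i j : 'I_(plength pi), (pvalue i < pvalue j)%N ->
     half_lt (cell i).2 (cell j).2 (d i) (d j)).

Lemma standard_figure_offset (R : realType) (t u : nat) (M : 'M[int]_(t, u))
    (z : R * R) :
  standard_figure M z ->
  exists e : (('I_t * bool) * ('I_u * bool)) * R,
    [/\ 0 <= e.2 <= 2^-1, z.1 = offset e.1.1 e.2 & z.2 = offset e.1.2 e.2].
Proof.
move=> [k [l]].
case=> -[_ [s /andP[s0 s1] ->]] /=; rewrite /offset.
(* As the slopes are 1 and -1, the distance to the nearer end is the same along both axes: [s] up to
   the midpoint, [1 - s] beyond it. A falling segment pairs left half-columns with upper
   half-rows. *)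
all: rewrite -(natr1 k) -(natr1 l); have [s2|s2] := lerP s 2^-1.
- by exists (((k, false), (l, false)), s);
    split=> /=; [apply/andP; split| |]; lra.
- by exists (((k, true), (l, true)), 1 - s);
    split=> /=; [apply/andP; split| |]; lra.
- by exists (((k, false), (l, true)), s);
    split=> /=; [apply/andP; split| |]; lra.
- by exists (((k, true), (l, false)), 1 - s);
    split=> /=; [apply/andP; split| |]; lra.
Qed.

Lemma Geom_encodes (R : realType) (t u : nat) (M : 'M[int]_(t, u))
    (pi : permutation) :
  Geom R M pi ->
  exists e : 'I_(plength pi) -> (('I_t * bool) * ('I_u * bool)) * R,
    encodes (fun i => (e i).1) (fun i => (e i).2).
Proof.
move=> [A [_ _ AM [f [[_ _ fsurj] fle]]]].
have pts (i : 'I_(plength pi)) :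
    exists p, A p /\ f p = (i.+1%:R, (pvalue i).+1%:R).
  have [|p Ap fp] := fsurj (i.+1%:R, (pvalue i).+1%:R); first by exists i.
  by exists p.
have [pt ptP] := choice pts.
have codes i := standard_figure_offset (AM _ (ptP i).1).
have [e eP] := choice codes.
exists e; split=> i j lt_ij; have [di xi yi] := eP i; have [dj xj yj] := eP j;
  apply: offset_lt_half_lt => //; rewrite -?xi -?xj -?yi -?yj.
  by apply/(fle _ _ (ptP i).1 (ptP j).1).1; rewrite !(ptP _).2 ltr_nat ltnS.
by apply/(fle _ _ (ptP i).1 (ptP j).1).2; rewrite !(ptP _).2 ltr_nat ltnS.
Qed.

(** * From word embeddings to embeddings of labelled permutations *)

(** Within one half, a reversal would need a strict inequality against the weak one inherited from
    [c] and [c']. Coincident images must be excluded separately. *)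
Lemma half_lt_transfer (R : realType) (t : nat) (a a' : 'I_t * bool)
    (c c' e e' : R) :
  half_lt a a' c c' ->
  (c < c' -> e <= e') -> (c' < c -> e' <= e) -> ~ half_lt a' a e' e.
Proof.
move=> H lec gec; case: H => [lt_a|[<- lt_c]] [].
- by move/(ltn_trans lt_a); rewrite ltnn.
- by case=> E _; move: lt_a; rewrite E ltnn.
- by rewrite ltnn.
- case=> _; case: ifP lt_c => _ lt_c; apply/negP; rewrite -leNgt; auto.
Qed.

Definition by_increasing (R : realType) (n : nat) (d : 'I_n -> R) : seq 'I_n :=
  sort (fun i j => d i <= d j) (enum 'I_n).

Lemma pairwise_by_increasing (R : realType) (n : nat) (d : 'I_n -> R) :
  pairwise (fun i j => d i <= d j) (by_increasing d).
Proof.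
rewrite -sorted_pairwise; last by move=> j i k; apply: le_trans.
by apply: sort_sorted => i j; apply: le_total.
Qed.

Lemma encoded_embedding (R : realType) (t u : nat) (X : set permutation)
    (L : Type) (leL : L -> L -> Prop) (s p : labelled X L)
    (es : 'I_(plength (lperm s)) -> (('I_t * bool) * ('I_u * bool)) * R)
    (ep : 'I_(plength (lperm p)) -> (('I_t * bool) * ('I_u * bool)) * R) :
  encodes (fun i => (es i).1) (fun i => (es i).2) ->
  encodes (fun i => (ep i).1) (fun i => (ep i).2) ->
  embeds (fun x y => x.1 = y.1 /\ leL x.2 y.2)
    [seq ((es i).1, label i) | i <- by_increasing (fun i => (es i).2)]
    [seq ((ep i).1, label i) | i <- by_increasing (fun i => (ep i).2)] ->
  labelled_le leL s p.
Proof.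
move=> [esx esy] [epx epy] /embeds_map emb.
have [|Q [Qex QP Qd]] := embeds_sorted_choice emb (pairwise_by_increasing _)
  (pairwise_by_increasing _).
  by rewrite sort_uniq enum_uniq.
have [|f fQ] := @choice _ _ Q.
  by move=> i; apply: Qex; rewrite mem_sort mem_enum.
have fcell i : (es i).1 = (ep (f i)).1 by have [_ _ []] := QP _ _ (fQ i).
have fle i j (lt_d : (es i).2 < (es j).2) := (Qd _ _ _ _ (fQ i) (fQ j) lt_d).2.
have fneq i j : (es i).2 < (es j).2 -> f i <> f j.
  by move=> lt_d; have [] := Qd _ _ _ _ (fQ i) (fQ j) lt_d.
(* Points in different halves go to different cells; points in the same half have different
   distances, so [fneq] applies. *)
have half_neq r (g : _ -> 'I_r * bool) i j :
    half_lt (g (es i).1) (g (es j).1) (es i).2 (es j).2 -> f i <> f j.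
  case=> [lt_g fij|[_ lt_d]].
    by move: lt_g; rewrite !fcell fij ltnn.
  by case: ifP lt_d => _ /fneq // fji /esym.
have fx (i j : 'I_(plength (lperm s))) : (i < j)%N -> (f i < f j)%N.
  (* Of the three possible orders of the images, the transfer lemma excludes the reversed one and
     [half_neq] equality. *)
  move=> /esx H; have [//|/epx H'|/val_inj] := ltngtP (f i) (f j).
    by case: (half_lt_transfer H (fle i j) (fle j i)); rewrite !fcell.
  by case/(half_neq _ fst).
have fy (i j : 'I_(plength (lperm s))) : (pvalue i < pvalue j)%N ->
    (pvalue (f i) < pvalue (f j))%N.
  move=> /esy H; have [//|/epy H'|/val_inj/perm_inj] :=
    ltngtP (pvalue (f i)) (pvalue (f j)).
    by case: (half_lt_transfer H (fle i j) (fle j i)); rewrite !fcell.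
  by case/(half_neq _ snd).
exists f; split=> // [i j|j]; last by have [_ _ []] := QP _ _ (fQ j).
split; first exact: fy.
have [//|/fy lt_ji /(ltn_trans lt_ji)|/val_inj/perm_inj ->] :=
  ltngtP (pvalue i) (pvalue j); by rewrite ltnn.
Qed.

Lemma labelled_le_quasi_order (X : set permutation) (L : Type)
    (leL : L -> L -> Prop) :
  quasi_order leL -> quasi_order (@labelled_le X L leL).
Proof.
move=> [leL_refl leL_trans]; split=> [s|s p q [f [fx fy fl]] [g [gx gy gl]]].
  by exists id; split.
exists (g \o f); split=> [i j /fx/gx //|i j|j] /=.
  by rewrite fy gy.
exact: leL_trans (fl j) (gl (f j)).
Qed.

Theorem theorem8p5 (R : realType) (t u : nat) (M : 'M[int]_(t, u))
  (hM : forall (k : 'I_t) (l : 'I_u), M k l = 0 \/ M k l = 1 \/ M k l = -1) :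
  lwqo (Geom R M).
Proof.
move=> L leL wL; split; first exact: labelled_le_quasi_order wL.1.
move=> y.
have [e eP] : exists e : forall n, 'I_(plength (lperm (y n))) ->
    (('I_t * bool) * ('I_u * bool)) * R,
    forall n, encodes (fun i => (e n i).1) (fun i => (e n i).2).
  (* The domain of [e n] varies with [n], hence [cid] for each [n] instead of [choice]. *)
  have ex n := cid (Geom_encodes (lperm_in (y n))).
  by exists (fun n => projT1 (ex n)) => n; apply: (projT2 (ex n)).
have [i [j [ij emb]]] := higman (wqo_finType_prod _ wL)
  (fun n => [seq ((e n i).1, label i)
    | i <- by_increasing (fun i => (e n i).2)]).
by exists i, j; split=> //; apply: encoded_embedding emb.
Qed.
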